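(* Let $p$ be a prime and let $G$ be a torsion-free abelian group with a $p$-adic sublinear pseudometric $t$. Suppose that $H$ is a subgroup of $G$ and $f:H\to\mathbb{Z}_p$ is a $t$-contractive functional on $H$. Then there exists a $t$-contractive functional $f':G\to\mathbb{Z}_p$ on $G$ that extends $f$.
   Context: $\mathbb{Z}_p$ denotes the $p$-adic integers and $|\cdot|_p$ the $p$-adic absolute value. The $p$-adic pseudometric on a torsion-free abelian group $G$ is $d_p(g,h)=p^{-k}$, where $k\ge 0$ is the largest integer with $g-h\in p^kG$, and $d_p(g,h)=0$ if $g-h\in p^kG$ for all $k$. A $p$-adic sublinear pseudometric on $G$ is a pseudometric $t:G\times G\to\mathbb{R}_{\ge 0}$ such that, for all $g_1,g_2,g_3,h\in G$ and $n\in\mathbb{Z}$: (1) $t(g_1,g_2)=t(g_1+h,g_2+h)$; (2) $t(ng_1,ng_2)=|n|_p\,t(g_1,g_2)$; (3) $t(g_1,g_2)\le d_p(g_1,g_2)$; (4) $t(g_1,g_2)\le\max\{t(g_1,g_3),t(g_2,g_3)\}$. For a subgroup $H$ of $G$, a $t$-contractive functional on $H$ is a group homomorphism $f:H\to\mathbb{Z}_p$ with $|f(h_1)-f(h_2)|_p\le t(h_1,h_2)$ for all $h_1,h_2\in H$. *)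

(* Defs.v *)
From HB Require Import structures.
From mathcomp Require Import all_boot all_order all_algebra.
From mathcomp Require Import boolp classical_sets reals.

Set Implicit Arguments.
Unset Strict Implicit.
Unset Printing Implicit Defensive.

Import Order.TTheory GRing.Theory Num.Theory.
Local Open Scope ring_scope.

(* The p-adic integers are the inverse limit of the rings Z / p^(n+1), n : nat,
   along the reduction maps: the component of index n is the residue modulo
   p^(n+1). Indices are shifted by one because 'Z_m is Z/m only for m > 1. *)
Record padic_int (p : nat) := PadicInt {
  residue :> forall n, 'Z_(p ^ n.+1);
  residueP : forall n, residue n = inZp (residue n.+1) }.

Section PadicIntRing.
Variable p : nat.
Implicit Types x y z : padic_int p.

HB.instance Definition _ := gen_eqMixin (padic_int p).
HB.instance Definition _ := gen_choiceMixin (padic_int p).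

Lemma padic_int_eq x y : (forall n, x n = y n) -> x = y.
Proof.
case: x y => [x xP] [y yP] /= exy.
have {}exy : x = y by apply: functional_extensionality_dep.
by rewrite -exy in yP *; congr PadicInt; apply: Prop_irrelevance.
Qed.

Let reduce n : 'Z_(p ^ n.+2) -> 'Z_(p ^ n.+1) := fun a => inZp a.

Let dvd_trunc n :
  ((Zp_trunc (p ^ n.+1)).+2 %| (Zp_trunc (p ^ n.+2)).+2)%N.
Proof.
have [p_gt1|p_le1] := ltnP 1 p.
  by rewrite !Zp_cast ?dvdn_exp2l // -[1%N](expn0 p) ltn_exp2l.
by case: p p_le1 => [|[|//]] _; rewrite ?exp1n ?exp0n.
Qed.

Let reduceD n (a b : 'Z_(p ^ n.+2)) : reduce (a + b) = reduce a + reduce b.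
Proof. by apply: val_inj; rewrite /= modn_dvdm ?dvd_trunc // modnDm. Qed.

Let reduceM n (a b : 'Z_(p ^ n.+2)) : reduce (a * b) = reduce a * reduce b.
Proof. by apply: val_inj; rewrite /= modn_dvdm ?dvd_trunc // modnMm. Qed.

Let reduce0 n : reduce (0 : 'Z_(p ^ n.+2)) = 0.
Proof. by apply: val_inj; rewrite /= mod0n. Qed.

Let reduce1 n : reduce (1 : 'Z_(p ^ n.+2)) = 1.
Proof. exact: val_inj. Qed.

Let reduceN n (a : 'Z_(p ^ n.+2)) : reduce (- a) = - reduce a.
Proof. by apply/eqP; rewrite -addr_eq0 -reduceD addNr reduce0. Qed.

Definition padic_zero : padic_int p :=
  @PadicInt p (fun=> 0) (fun n => esym (reduce0 n)).

Definition padic_one : padic_int p :=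
  @PadicInt p (fun=> 1) (fun n => esym (reduce1 n)).

Fact padic_opp_subproof x n : - x n = inZp (- x n.+1)%R.
Proof. by rewrite [RHS]reduceN [x n]residueP. Qed.

Definition padic_opp x := PadicInt (padic_opp_subproof x).

Fact padic_add_subproof x y n : x n + y n = inZp (x n.+1 + y n.+1)%R.
Proof. by rewrite [RHS]reduceD [x n]residueP [y n]residueP. Qed.

Definition padic_add x y := PadicInt (padic_add_subproof x y).

Fact padic_mul_subproof x y n : x n * y n = inZp (x n.+1 * y n.+1)%R.
Proof. by rewrite [RHS]reduceM [x n]residueP [y n]residueP. Qed.

Definition padic_mul x y := PadicInt (padic_mul_subproof x y).

Fact padic_addA : associative padic_add.
Proof. by move=> x y z; apply: padic_int_eq => n; apply: addrA. Qed.

Fact padic_addC : commutative padic_add.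
Proof. by move=> x y; apply: padic_int_eq => n; apply: addrC. Qed.

Fact padic_add0 : left_id padic_zero padic_add.
Proof. by move=> x; apply: padic_int_eq => n; apply: add0r. Qed.

Fact padic_addN : left_inverse padic_zero padic_opp padic_add.
Proof. by move=> x; apply: padic_int_eq => n; apply: addNr. Qed.

HB.instance Definition _ := GRing.isZmodule.Build (padic_int p)
  padic_addA padic_addC padic_add0 padic_addN.

Fact padic_mulA : associative padic_mul.
Proof. by move=> x y z; apply: padic_int_eq => n; apply: mulrA. Qed.

Fact padic_mulC : commutative padic_mul.
Proof. by move=> x y; apply: padic_int_eq => n; apply: mulrC. Qed.

Fact padic_mul1 : left_id padic_one padic_mul.
Proof. by move=> x; apply: padic_int_eq => n; apply: mul1r. Qed.

Fact padic_mulDl : left_distributive padic_mul +%R.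
Proof. by move=> x y z; apply: padic_int_eq => n; apply: mulrDl. Qed.

Fact padic_one_neq0 : padic_one != 0.
Proof. by apply/eqP => /(congr1 (fun x : padic_int p => val (x 0))). Qed.

HB.instance Definition _ := GRing.Zmodule_isComNzRing.Build (padic_int p)
  padic_mulA padic_mulC padic_mul1 padic_mulDl padic_one_neq0.

End PadicIntRing.

Section AbsoluteValues.
Variables (R : realType) (p : nat).

Definition int_padic_abs (n : int) : R :=
  if n == 0 then 0 else p%:R ^- logn p `|n|%N.

(* Since x n is the residue of x modulo p^(n+1), the least n with x n != 0 is
   the largest k such that p^k divides x. *)
Definition padic_abs (x : padic_int p) : R :=
  if pselect (exists n, x n != 0) is left ex then p%:R ^- ex_minn ex else 0.

Definition in_ppow (G : zmodType) (k : nat) (g : G) : Prop :=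
  exists x : G, g = x *+ (p ^ k)%N.

Definition padic_dist (G : zmodType) (g h : G) : R :=
  if pselect (forall k, in_ppow k (g - h)) then 0
  else p%:R ^- xget 0%N [set k | in_ppow k (g - h) /\
                                 forall j, in_ppow j (g - h) -> (j <= k)%N].

End AbsoluteValues.

(* The definitions above agree with one another: on the additive group of
   p-adic integers the p-adic pseudometric is |x - y|_p, and |.|_p restricts to
   the usual absolute value on int. *)
Section Coherence.
Variables (R : realType) (p : nat).
Hypothesis p_prime : prime p.
Implicit Types x y : padic_int p.

Let pow_gt1 n : (1 < p ^ n.+1)%N.
Proof. by rewrite -[1%N](expn0 p) ltn_exp2l ?prime_gt1. Qed.

Let trunc_pow n : (Zp_trunc (p ^ n.+1)).+2 = (p ^ n.+1)%N.
Proof. exact: Zp_cast. Qed.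

Let modn_trunc n a : (a %% (Zp_trunc (p ^ n.+1)).+2 = a %% p ^ n.+1)%N.
Proof. by rewrite trunc_pow. Qed.

Lemma residue_natmul x k n :
  nat_of_ord ((x *+ k) n) = (x n * k %% p ^ n.+1)%N.
Proof.
have -> : (x *+ k) n = x n *+ k.
  elim: k => [|k IHk] //; rewrite !mulrS -IHk //.
by rewrite -mulr_natr Zp_nat /= modnMmr modn_trunc.
Qed.

Lemma residue_mod x n m :
  (n <= m)%N -> nat_of_ord (x n) = (x m %% p ^ n.+1)%N.
Proof.
move=> /subnK <-; elim: (m - n)%N => [|i IHi].
  by rewrite add0n modn_small // -[X in (_ < X)%N]trunc_pow ltn_ord.
rewrite IHi [x (i + n)%N]residueP /= modn_trunc modn_dvdm // dvdn_exp2l //.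
by rewrite ltnS leq_addl.
Qed.

Lemma in_ppow_residue x k :
  in_ppow p k x <-> forall n, (n < k)%N -> x n = 0.
Proof.
split=> [[y ->] n ltnk|x0].
  apply: val_inj; rewrite /= residue_natmul; apply/eqP.
  by rewrite -/(dvdn _ _) dvdn_mull // dvdn_exp2l.
have dvd_x n : (p ^ k %| x (n + k)%N)%N.
  case: k x0 => [|k] x0; first by rewrite dvd1n.
  rewrite /dvdn -residue_mod ?x0 //.
  by rewrite addnS leqW ?leq_addl.
have pk_gt0 : (0 < p ^ k)%N by rewrite expn_gt0 prime_gt0.
pose r n : 'Z_(p ^ n.+1) := inZp (x (n + k)%N %/ p ^ k)%N.
have rP n : r n = inZp (r n.+1).
  apply: val_inj; rewrite /= !modn_trunc modn_dvdm ?dvdn_exp2l //.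
  rewrite (@residue_mod x (n + k)%N (n.+1 + k)%N) ?leq_add2r //.
  by rewrite [in X in (X %/ _)%N](_ : (n + k).+1 = n.+1 + k)%N // expnD
    -modn_divl modn_mod.
exists (PadicInt rP); apply: padic_int_eq => n; apply: val_inj.
rewrite /= residue_natmul /= modn_trunc modnMml divnK //.
by rewrite -residue_mod // leq_addr.
Qed.

Lemma padic_distE x y : padic_dist R p x y = padic_abs R (x - y).
Proof.
rewrite /padic_dist /padic_abs; set z := x - y.
case: pselect => [zall|znall]; case: pselect => [zex|znex] //.
- have [n /eqP zn] := zex; case: zn.
  by apply: (proj1 (in_ppow_residue z n.+1)).
- case: ex_minnP => k zk kmin; congr (_ ^- _).
  case: xgetP => [_ -> /= [zj jmax]|noK]; last first.
    case: (noK k); split=> [|j /in_ppow_residue zj].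
      apply/in_ppow_residue => n; apply: contraTeq => /kmin.
      by rewrite -leqNgt.
    by rewrite leqNgt; apply: contra zk => /zj ->.
  set j := xget _ _ in zj jmax *.
  apply/eqP; rewrite eqn_leq jmax ?andbT.
    rewrite leqNgt; apply: contra zk => /(proj1 (in_ppow_residue _ _) zj) -> //.
  apply/in_ppow_residue => n; apply: contraTeq => /kmin.
  by rewrite -leqNgt.
- case: znall => k; apply/in_ppow_residue => n _.
  by apply/eqP/negPn/negP => zn; apply: znex; exists n.
Qed.

Lemma padic_abs_int (n : int) :
  padic_abs R (n%:~R : padic_int p) = int_padic_abs R p n.
Proof.
have resE m : ((n%:~R : padic_int p) m == 0) = (p ^ m.+1 %| `|n|)%N.
  have natE (k : nat) : ((k%:R : padic_int p) m == 0) = (p ^ m.+1 %| k)%N.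
    by rewrite -val_eqE /= residue_natmul mul1n -/(dvdn _ _).
  case: n => k; first exact: natE.
  by rewrite NegzE mulrNz [X in X == 0](_ : _ = - ((k.+1)%:R : padic_int p) m)
    // oppr_eq0 natE abszN.
rewrite /padic_abs /int_padic_abs; case: eqP => [n0|/eqP nN0].
  case: pselect => // ex; exfalso; case: ex => m.
  by rewrite resE n0 dvdn0.
have absn_gt0 : (0 < `|n|)%N by rewrite absz_gt0.
have zE m : ((n%:~R : padic_int p) m != 0) = (logn p `|n| <= m)%N.
  by rewrite resE pfactor_dvdn // -leqNgt.
case: pselect => [ex|[]]; last by exists (logn p `|n|); rewrite zE.
case: ex_minnP => k; rewrite zE => lek kmin.
by congr (_ ^- _); apply/eqP; rewrite eqn_leq lek andbT kmin // zE.
Qed.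

End Coherence.

Definition torsion_free (G : zmodType) : Prop :=
  forall (g : G) (n : nat), (0 < n)%N -> g *+ n = 0 -> g = 0.

Record pseudometric (R : realType) (T : Type) (t : T -> T -> R) : Prop := {
  pseudometric_ge0 : forall x y, 0 <= t x y;
  pseudometric_refl : forall x, t x x = 0;
  pseudometric_sym : forall x y, t x y = t y x;
  pseudometric_triangle : forall x y z, t x z <= t x y + t y z }.

Record padic_sublinear (R : realType) (p : nat) (G : zmodType)
    (t : G -> G -> R) : Prop := {
  sublinear_pseudometric : pseudometric t;
  sublinear_translation : forall g1 g2 h, t g1 g2 = t (g1 + h) (g2 + h);
  sublinear_scaling : forall g1 g2 (n : int),
    t (g1 *~ n) (g2 *~ n) = int_padic_abs R p n * t g1 g2;
  sublinear_le_dist : forall g1 g2, t g1 g2 <= padic_dist R p g1 g2;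
  sublinear_max : forall g1 g2 g3,
    t g1 g2 <= Num.max (t g1 g3) (t g2 g3) }.

Definition contractive (R : realType) (p : nat) (A : zmodType)
    (t : A -> A -> R) (f : {additive A -> padic_int p}) : Prop :=
  forall a b, padic_abs R (f a - f b) <= t a b.

Definition subgroup (G : zmodType) (H : zmodClosed G) := {g : G | g \in H}.

HB.instance Definition _ (G : zmodType) (H : zmodClosed G) :=
  SubChoice.on (subgroup H).
HB.instance Definition _ (G : zmodType) (H : zmodClosed G) :=
  [SubChoice_isSubZmodule of subgroup H by <:].

(* Main.v *)
(* As in the Hahn-Banach theorem, Zorn's lemma reduces the claim to extending a
   contractive functional by one value z at an element g. The conditions on z
   are that it lies in certain balls of Z_p; by the ultrametric inequality for
   t these balls intersect pairwise, hence have a common point because Z_p is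
   spherically complete. *)
From HB Require Import structures.
Require Import Defs.
From mathcomp Require Import all_boot all_order all_algebra reals.
From mathcomp Require Import boolp classical_sets.
Import Order.TTheory GRing.Theory Num.Theory.
Local Open Scope ring_scope.

Set Implicit Arguments.
Unset Strict Implicit.
Unset Printing Implicit Defensive.

(** * Absolute value, divisibility and spherical completeness in Z_p *)

Section PadicAbs.
Variables (R : realType) (p : nat).
Hypothesis p_prime : prime p.
Implicit Types (x y w : padic_int p) (r : R).

Local Notation "`| x |_p" := (@padic_abs R p x) (format "`| x |_p").

Lemma invpX_gt0 k : 0 < (p%:R : R) ^- k.
Proof. by rewrite invr_gt0 exprn_gt0 // ltr0n prime_gt0. Qed.

Lemma invpX_le1 k : (p%:R : R) ^- k <= 1.
Proof. by rewrite invf_le1 ?exprn_gt0 ?exprn_ege1 ?ler1n ?ltr0n ?prime_gt0. Qed.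

Lemma ler_invpX j k : ((p%:R : R) ^- j <= p%:R ^- k) = (k <= j)%N.
Proof.
rewrite lef_pV2 ?posrE ?exprn_gt0 ?ltr0n ?prime_gt0 //.
by rewrite ler_eXn2l // ltr1n prime_gt1.
Qed.

Lemma padic_abs_ge0 x : 0 <= `|x|_p.
Proof. by rewrite /padic_abs; case: pselect => // ex; rewrite ltW ?invpX_gt0. Qed.

(** Turns norm bounds into statements on single residues, without the least index. The sign of [r]
    matters for [x = 0], where the right side is vacuous. *)
Lemma padic_abs_leP x r : 0 <= r ->
  reflect (forall k, x k != 0 -> p%:R ^- k <= r) (`|x|_p <= r).
Proof.
move=> r_ge0; apply: (iffP idP) => [xr k xk|xr]; last first.
  rewrite /padic_abs; case: pselect => // ex.
  by case: ex_minnP => k xk _; apply: xr.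
apply: le_trans xr; rewrite /padic_abs; case: pselect => [ex|[]]; last by exists k.
by case: ex_minnP => j _ /(_ _ xk); rewrite ler_invpX.
Qed.

Lemma residue_neq0_le x k : x k != 0 -> p%:R ^- k <= `|x|_p.
Proof. by move: k; apply/padic_abs_leP; rewrite ?padic_abs_ge0. Qed.

Lemma padic_abs_le1 x : `|x|_p <= 1.
Proof. by apply/padic_abs_leP => // k _; apply: invpX_le1. Qed.

Lemma padic_abs_le0 x : `|x|_p <= 0 -> x = 0.
Proof.
move=> /padic_abs_leP x0; apply: padic_int_eq => k; apply/eqP/negPn/negP.
by move=> /x0 -/(_ (lexx _)); rewrite leNgt invpX_gt0.
Qed.

Lemma padic_abs0 : `|0 : padic_int p|_p = 0.
Proof.
by apply/le_anti; rewrite padic_abs_ge0 andbT; apply/padic_abs_leP => // k /eqP.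
Qed.

Lemma padic_absN x : `|- x|_p = `|x|_p.
Proof.
suff le y : `|- y|_p <= `|y|_p
  by apply/le_anti/andP; split; rewrite ?le // -{1}[x]opprK le.
apply/padic_abs_leP => [|k yk]; first exact: padic_abs_ge0.
by apply: residue_neq0_le; rewrite -oppr_eq0.
Qed.

Lemma padic_absD x y r : `|x|_p <= r -> `|y|_p <= r -> `|x + y|_p <= r.
Proof.
move=> xr yr; have r0 := le_trans (padic_abs_ge0 x) xr.
move/(padic_abs_leP _ r0) in xr; move/(padic_abs_leP _ r0) in yr.
apply/padic_abs_leP => // k xyk.
have [xk|] := eqVneq (x k) 0; last exact: xr.
by apply: yr; apply: contraNneq xyk => yk; rewrite [X in X == _](_ : _ = x k + y k) // xk yk addr0.
Qed.

(** The part of [m] prime to p is a unit modulo p^(k+1), so only p^a with [a = logn p m] counts: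
    p^(k+1) divides x p^a iff k < a or p^(k-a+1) divides x. *)
Lemma residue_natmul_eq0 x m k : (0 < m)%N ->
  ((x *+ m) k == 0) = (k < logn p m)%N || (x (k - logn p m)%N == 0).
Proof.
move=> m0; rewrite -!val_eqE /= residue_natmul // -/(dvdn _ _).
rewrite (@residue_mod _ p_prime x (k - logn p m)%N k) ?leq_subr // -/(dvdn _ _).
have [m' pm' {1}->] := pfactor_coprime p_prime m0.
rewrite mulnCA Gauss_dvdr ?coprimeXl //; have [ka|ak] := ltnP k (logn p m).
  by rewrite dvdn_mull // dvdn_exp2l.
rewrite -{1}(subnK ak) -addSn expnD dvdn_pmul2r ?expn_gt0 ?prime_gt0 //.
Qed.

(** Multiplication by [m] shifts the first nonzero residue by [logn p m]. *)
Lemma padic_abs_natmul x m : (0 < m)%N ->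
  `|x *+ m|_p = p%:R ^- logn p m * `|x|_p.
Proof.
move=> m0; set a := logn p m; apply/le_anti/andP; split.
  apply/padic_abs_leP => [|k].
    by rewrite mulr_ge0 ?padic_abs_ge0 // ltW ?invpX_gt0.
  rewrite residue_natmul_eq0 // negb_or -leqNgt -/a => /andP[ak xk].
  by rewrite -(subnK ak) addnC exprD invfM ler_pM2l ?invpX_gt0 ?residue_neq0_le.
rewrite mulrC ler_pdivrMr ?exprn_gt0 ?ltr0n ?prime_gt0 //.
apply/padic_abs_leP => [|k xk].
  by rewrite mulr_ge0 ?padic_abs_ge0 ?exprn_ge0.
rewrite -ler_pdivrMr ?exprn_gt0 ?ltr0n ?prime_gt0 // -invfM -exprD addnC.
apply: residue_neq0_le; rewrite residue_natmul_eq0 // -/a negb_or addKn xk.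
by rewrite -leqNgt leq_addr.
Qed.

Lemma int_padic_abs_gt0 n : n != 0 -> 0 < int_padic_abs R p n.
Proof. by rewrite /int_padic_abs => /negPf->; apply: invpX_gt0. Qed.

Lemma padic_abs_mulz x n : `|x *~ n|_p = int_padic_abs R p n * `|x|_p.
Proof.
rewrite /int_padic_abs; case: eqP => [->|]; first by rewrite mulr0z padic_abs0 mul0r.
case: n => [[|m]|m] // _; first by rewrite padic_abs_natmul.
by rewrite NegzE mulrNz padic_absN padic_abs_natmul // abszN.
Qed.

(** Since [m] is a unit modulo each p^(n+1), one divides residue by residue. The quotients are
    compatible because they are so after multiplication by [m]. *)
Lemma padic_div_coprime x m : coprime p m -> exists y, y *+ m = x.
Proof.
move=> pm.
have castP n : (Zp_trunc (p ^ n.+1)).+2 = (p ^ n.+1)%N.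
  by rewrite Zp_cast // -[1%N](expn0 p) ltn_exp2l ?prime_gt1.
have mU n : (m%:R : 'Z_(p ^ n.+1)) \is a GRing.unit.
  by rewrite unitZpE ?coprimeXl // -[1%N](expn0 p) ltn_exp2l ?prime_gt1.
pose y n : 'Z_(p ^ n.+1) := x n / m%:R.
have ym n : y n *+ m = x n by rewrite -mulr_natr (divrK (mU n)).
have yP n : y n = inZp (y n.+1).
  apply: (mulIr (mU n)); rewrite (divrK (mU n)) [LHS]residueP -ym mulr_natr !Zp_mulrn.
  have dvdP : ((Zp_trunc (p ^ n.+1)).+2 %| (Zp_trunc (p ^ n.+2)).+2)%N.
    by rewrite !castP dvdn_exp2l.
  by move: (y n.+1) => b; apply: val_inj; rewrite /= modnMml modn_dvdm.
exists (PadicInt yP); apply: padic_int_eq => n; apply: val_inj.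
rewrite [LHS](residue_natmul p_prime _ m n) -[in RHS](ym n) Zp_mulrn /=.
by congr (_ %% _)%N; rewrite castP.
Qed.

(** The bound kills the residues of [x] below the valuation of [n], so that power of p can be
    divided out; the rest of [n] is prime to p. *)
Lemma padic_div x n : n != 0 -> `|x|_p <= int_padic_abs R p n ->
  exists y, y *~ n = x.
Proof.
move=> n0; rewrite /int_padic_abs (negPf n0) => xn.
have n_gt0 : (0 < `|n|)%N by rewrite absz_gt0.
have [m pm En] := pfactor_coprime p_prime n_gt0.
have [y ->] : in_ppow p (logn p `|n|) x.
  apply/in_ppow_residue => // k; apply: contraTeq => /residue_neq0_le xk.
  by rewrite -leqNgt -ler_invpX (le_trans xk).
have [z <-] := padic_div_coprime y pm; rewrite -mulrnA -En.
case: (n) => k; first by exists z.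
by exists (- z); rewrite NegzE mulrNz mulNrz opprK abszN.
Qed.

Lemma padic_spherically_complete (S : padic_int p -> R -> Prop) :
    (forall w r w' r', S w r -> S w' r' -> `|w - w'|_p <= Num.max r r') ->
  exists z, forall w r, S w r -> `|z - w|_p <= r.
Proof.
move=> Snested.
(* Either the radii in [S] tend to 0, and the centers converge digit by digit,
   or there is a least k with all radii at least p^-k, and the center of any
   ball of radius less than p^-(k-1) will do. *)
have residue_eq w r w' r' k : S w r -> S w' r' ->
    r < p%:R ^- k -> r' < p%:R ^- k -> w k = w' k.
  move=> Sw Sw' rk r'k; apply/eqP; rewrite -subr_eq0; apply/negP => /negP wk.
  have /le_trans/(_ (Snested _ _ _ _ Sw Sw')) := @residue_neq0_le (w - w') k wk.
  by rewrite leNgt gt_max rk r'k.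
have S_ge0 w r : S w r -> 0 <= r.
  move=> Sw; rewrite -[r]maxxx; apply: le_trans (Snested _ _ _ _ Sw Sw).
  exact: padic_abs_ge0.
have [small|] := pselect (forall k, exists wr, S wr.1 wr.2 /\ wr.2 < p%:R ^- k).
  have [c cP] := choice small.
  have zP n : (c n).1 n = inZp ((c n.+1).1 n.+1).
    have [[Sn rn] [Sn1 rn1]] := (cP n, cP n.+1).
    rewrite -residueP; apply: residue_eq Sn Sn1 rn _.
    by apply: lt_le_trans rn1 _; rewrite ler_invpX.
  exists (PadicInt zP) => w r Sw; have [Sc rc] := (fun k => (cP k).1, fun k => (cP k).2).
  apply/padic_abs_leP => [|k]; first exact: S_ge0 Sw.
  rewrite leNgt; apply: contra => rk; rewrite subr_eq0; apply/eqP => /=.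
  exact: residue_eq (Sc k) Sw (rc k) rk.
move=> /existsNP[k0 k0P].
pose big k := `[< forall w r, S w r -> p%:R ^- k <= r >].
have /ex_minnP[k /asboolP kbig kmin] : exists k, big k.
  exists k0; apply/asboolP => w r Sw; rewrite leNgt; apply/negP => rk.
  by apply: k0P; exists (w, r).
(* For k = 0 all radii are at least 1, so every ball is Z_p. *)
case: k => [|k] in kbig kmin.
  by exists 0 => w r /kbig; apply: le_trans; rewrite expr0 invr1 padic_abs_le1.
have : ~~ big k by apply/negP => /kmin; rewrite ltnn.
move=> /asboolPn/existsNP[w /existsNP[r /not_implyP[Sw /negP]]].
rewrite -ltNge => rk; exists w => w' r' Sw'.
apply/padic_abs_leP => [|j wj]; first exact: S_ge0 Sw'.
(* The norm takes no value strictly between p^-(k+1) and p^-k: from p^-j <= r < p^-k follows p^-j <=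
   p^-(k+1), a lower bound of all radii. *)
have := le_trans (residue_neq0_le wj) (Snested _ _ _ _ Sw Sw').
rewrite le_max => /orP[jr|//]; apply: le_trans (kbig _ _ Sw').
by rewrite ler_invpX ltnNge -(ler_invpX k j) -ltNge (le_lt_trans jr).
Qed.

End PadicAbs.

Lemma mulrz_subr_closed (V : zmodType) (A : set V) :
  (forall a b, A a -> A b -> A (a - b)) -> forall a n, A a -> A (a *~ n).
Proof.
move=> AB a n Aa; have A0 : A 0 by rewrite -(subrr a); apply: AB.
have AN b : A b -> A (- b) by move=> Ab; rewrite -sub0r; apply: AB.
have An k : A (a *+ k).
  by elim: k => // k IHk; rewrite mulrSr -[X in _ + X]opprK; apply: AB => //; apply: AN.
by case: n => k; [apply: An | rewrite NegzE mulrNz; apply/AN/An].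
Qed.

(** * Extension of contractive graphs, by one element and then by Zorn's lemma *)

Section Extension.
Variables (R : realType) (p : nat).
Hypothesis p_prime : prime p.
Variables (G : zmodType) (t : G -> G -> R).
Hypothesis t_sublinear : padic_sublinear p t.

Lemma sublinear_sub0 g h : t (g - h) 0 = t g h.
Proof. by rewrite (sublinear_translation t_sublinear _ _ h) subrK add0r. Qed.

Lemma sublinear_le1 g : t g 0 <= 1.
Proof.
apply: le_trans (sublinear_le_dist t_sublinear _ _) _; rewrite /padic_dist.
by case: pselect => *; [apply: ler01 | apply: invpX_le1].
Qed.

Lemma sublinear0Mz g n : t (g *~ n) 0 = int_padic_abs R p n * t g 0.
Proof. by rewrite -{1}(mul0rz _ n) (sublinear_scaling t_sublinear). Qed.

Lemma sublinear_subr g h : t (g - h) 0 <= Num.max (t g 0) (t h 0).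
Proof. by rewrite sublinear_sub0; apply: sublinear_max t_sublinear _ _ _. Qed.

(* [A] is the graph of a contractive functional on a subgroup of [G]; the bound
   forces single-valuedness, as [t 0 0 = 0]. The empty set is allowed. *)
Definition contractive_graph (A : set (G * padic_int p)) : Prop :=
  (forall a b, A a -> A b -> A (a - b)) /\
  (forall a, A a -> padic_abs R a.2 <= t a.1 0).

Lemma contractive_graph_fun A g y z :
  contractive_graph A -> A (g, y) -> A (g, z) -> y = z.
Proof.
move=> [AB At] Ay Az; apply/subr0_eq/(@padic_abs_le0 R _ p_prime).
have := At _ (AB _ _ Ay Az); rewrite /= subrr.
by rewrite (pseudometric_refl (sublinear_pseudometric t_sublinear)).
Qed.

(* The condition on the value [z] at [g] coming from [a] in [A] and [n != 0] is
   that [z] lies in the ball of center [- a.2 / n] and radius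
   [t (a.1 + n g) 0 / |n|_p]; these balls pairwise intersect, and those whose
   center is not in Z_p contain Z_p. *)
Lemma contractive_graph_extension A g : contractive_graph A ->
  exists z, forall a n, A a ->
    padic_abs R (a.2 + z *~ n) <= t (a.1 + g *~ n) 0.
Proof.
move=> [AB At]; have AM := mulrz_subr_closed AB.
(* With denominators cleared, [S] holds just the balls whose center lies in Z_p. *)
pose S w r := exists a n, [/\ A a, n != 0, a.2 + w *~ n = 0 &
  r * int_padic_abs R p n = t (a.1 + g *~ n) 0].
have [z zP] : exists z, forall w r, S w r -> padic_abs R (z - w) <= r.
  apply: padic_spherically_complete => // w r w' r'.
  move=> [a [n [Aa n0 aw ra]]] [b [m [Ab m0 bw rb]]].
  have nmgt0 : 0 < int_padic_abs R p n * int_padic_abs R p m.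
    by rewrite mulr_gt0 ?int_padic_abs_gt0.
  (* After scaling by nm, the difference of the centers is the second coordinate of bn - am, an
     element of [A]; in its first coordinate the multiples of [g] can be inserted, since they
     cancel. *)
  rewrite -(ler_pM2l nmgt0) -mulrA -!padic_abs_mulz //.
  have -> : (w - w') *~ m *~ n = (b *~ n - a *~ m).2.
    have -> : (b *~ n - a *~ m).2 = b.2 *~ n - a.2 *~ m.
      by rewrite raddfB !raddfMz.
    move/eqP: aw; rewrite addr_eq0 => /eqP ->.
    move/eqP: bw; rewrite addr_eq0 => /eqP ->.
    by rewrite !mulrzBl !mulNrz opprK addrC -!mulrzA [m * n]mulrC.
  apply: le_trans (At _ (AB _ _ (AM _ _ Ab) (AM _ _ Aa))) _.
  have -> : (b *~ n - a *~ m).1 =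
      (b.1 + g *~ m) *~ n - (a.1 + g *~ n) *~ m.
    have -> : (b *~ n - a *~ m).1 = b.1 *~ n - a.1 *~ m.
      by rewrite raddfB !raddfMz.
    by rewrite !mulrzDl -!mulrzA [n * m]mulrC opprD addrACA subrr addr0.
  apply: le_trans (sublinear_subr _ _) _; rewrite !sublinear0Mz -ra -rb.
  rewrite (maxr_pMr _ _ (ltW nmgt0)) maxC.
  suff E c d e : c * (e * d) = d * c * e :> R.
    by rewrite !E [X in _ <= Num.max _ (X * _)]mulrC.
  by rewrite mulrCA mulrC [c * d]mulrC.
exists z => a n Aa; have [->|n0] := eqVneq n 0; first by rewrite !mulr0z !addr0 At.
have ngt0 := int_padic_abs_gt0 R p_prime n0.
(* Here the radius is at least 1 and any [z] works: both [a.2] and [z *~ n] satisfy the bound. *)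
have [nt|tn] := leP (int_padic_abs R p n) (t (a.1 + g *~ n) 0).
  apply: padic_absD => //; last first.
    rewrite padic_abs_mulz //; apply: le_trans nt.
    by rewrite ler_piMr ?padic_abs_le1 // ltW.
  apply: le_trans (At _ Aa) _; rewrite -[X in t X _](addrK (g *~ n)).
  apply: le_trans (sublinear_subr _ _) _; rewrite ge_max lexx /= sublinear0Mz.
  by apply: le_trans nt; rewrite ler_piMr ?sublinear_le1 // ltW.
(* Now the norm of [a.2] is at most that of [n], so the center lies in Z_p and the ball belongs to
   [S]. *)
have [w wE] : exists w, w *~ n = - a.2.
  apply: (@padic_div R) => //; rewrite padic_absN //.
  apply: le_trans (At _ Aa) _; rewrite -[X in t X _](addrK (g *~ n)).
  apply: le_trans (sublinear_subr _ _) _; rewrite ge_max (ltW tn) /=.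
  by rewrite sublinear0Mz ler_piMr ?sublinear_le1 // ltW.
have -> : a.2 + z *~ n = (z - w) *~ n by rewrite mulrzBl wE opprK addrC.
rewrite padic_abs_mulz // mulrC -ler_pdivlMr //; apply: zP.
by exists a, n; split; rewrite ?wE ?subrr // divfK // gt_eqF.
Qed.

Lemma contractive_graph_maximal A : contractive_graph A -> (exists a, A a) ->
  exists B, [/\ contractive_graph B, (A `<=` B)%classic &
    forall g, exists z, B (g, z)].
Proof.
move=> cA [a0 Aa0].
(* The empty chain has empty union, so [P] must admit the empty set; being strictly below [A], it is
   not maximal. *)
pose P B := contractive_graph B /\ ((exists b, B b) -> (A `<=` B)%classic).
have [F PF totF|B [[cB AB] Bmax]] := @Zorn_bigcup _ P.
  split; last first.
    by move=> [b [X FX Xb]] a Aa; exists X => //; apply: (PF _ FX).2 Aa; exists b.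
  split=> [a b [X FX Xa] [Y FY Yb]|a [X FX Xa]]; last exact: (PF _ FX).1.2.
  have [XY|YX] := totF _ _ FX FY.
    by exists Y => //; apply: (PF _ FY).1.1 => //; apply: XY.
  by exists X => //; apply: (PF _ FX).1.1 => //; apply: YX.
have Bne : exists b, B b.
  apply: contrapT => B0; apply: (Bmax A); last by split=> // _ a.
  by split=> [b Bb|/(_ _ Aa0) Ba0]; case: B0; [exists b | exists a0].
exists B; split=> // [|g]; first exact: AB.
have [z zP] := contractive_graph_extension g cB; exists z.
have [BB Bt] := cB; have [b0 Bb0] := Bne.
have B0 : B 0 by rewrite -(subrr b0); apply: BB.
(* The subgroup generated by [B] and [(g, z)]; its contractivity is exactly [zP]. *)
pose C := [set c | exists b n, B b /\ c = b + (g, z) *~ n]%classic.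
have BC : (B `<=` C)%classic by move=> b Bb; exists b, 0; rewrite mulr0z addr0.
apply: contrapT => nBgz; apply: (Bmax C).
  by split=> // CB; apply/nBgz/CB; exists 0, 1; rewrite add0r mulr1z.
split; last by move=> _; apply: subset_trans BC; apply: AB.
split=> [_ _ [a [n [Ba ->]]] [b [m [Bb ->]]]|_ [a [n [Ba ->]]]].
  exists (a - b), (n - m); split; first exact: BB.
  by rewrite mulrzBr opprD addrACA.
by have := zP a n Ba; rewrite !raddfD !raddfMz.
Qed.

End Extension.

(** * From a graph over all of [G] to a functional *)

Theorem proposition3p13 (R : realType) (p : nat) (p_prime : prime p)
    (G : zmodType) (G_torsion_free : torsion_free G)
    (t : G -> G -> R) (t_sublinear : padic_sublinear p t)
    (H : zmodClosed G) (f : {additive subgroup H -> padic_int p})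
    (f_contractive : contractive (fun h1 h2 : subgroup H => t (val h1) (val h2)) f) :
  exists f' : {additive G -> padic_int p},
    contractive t f' /\ forall h : subgroup H, f' (val h) = f h.
Proof.
pose A := range (fun h : subgroup H => (val h, f h)).
have cA : contractive_graph t A.
  split=> [_ _ [h _ <-] [k _ <-]|_ [h _ <-]].
    by exists (h - k) => //; rewrite !raddfB.
  by have := f_contractive h 0; rewrite !raddf0 addr0.
have [|B [cB AB Btot]] := contractive_graph_maximal p_prime t_sublinear cA.
  by exists (val (0 : subgroup H), f 0), 0.
have [f' f'P] := choice Btot.
(* Closure of [B] under differences puts [f' g - f' h] over [g - h], and [B] is single-valued. *)
have f'B : zmod_morphism f'.
  move=> g h; apply: (contractive_graph_fun p_prime t_sublinear cB (f'P (g - h))).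
  exact: cB.1 (f'P g) (f'P h).
pose f'add := GRing.isZmodMorphism.Build G (padic_int p) f' f'B.
pose F : {additive G -> padic_int p} := HB.pack f' f'add.
exists F; split=> [g h|h] /=.
  by rewrite -(sublinear_sub0 t_sublinear); apply: cB.2 _ (cB.1 _ _ (f'P g) (f'P h)).
apply: (contractive_graph_fun p_prime t_sublinear cB (f'P (val h))).
by apply: AB; exists h.
Qed.
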